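(* Let $V\subseteq\mathbb{R}^n$ be a non-empty convex set, $G:V\times V\times(0,1]\to\mathbb{R}$ a map, and $Q:V\to\mathbb{R}$ a function. Then $Q$ is a $GS$-exponential kind of convex function associated with the map $G$ if and only if its epigraph $E(Q)=\{(m,\alpha): m\in V,\ \alpha\in\mathbb{R},\ Q(m)\le\alpha\}$ is a $GS$-exponential kind of convex set associated with the map $G$.
   Context: Fix $s\in(0,1]$ (the same $s$ in both definitions). Let $V\subseteq\mathbb{R}^n$ be a non-empty convex set. A function $Q:V\to\mathbb{R}$ is a $GS$-exponential kind of convex function on $V$ associated with the map $G:V\times V\times(0,1]\to\mathbb{R}$ if $$Q(am_1+(1-a)m_2)\le (e^a-1)^sQ(m_1)+(e^{1-a}-1)^sQ(m_2)+aG(m_1,m_2,s)$$ for all $m_1,m_2\in V$ and all $a\in[0,1]$. A non-empty set $U\subseteq V\times\mathbb{R}\subseteq\mathbb{R}^{n+1}$ is a $GS$-exponential kind of convex set associated with the map $G$ if for all $(m_1,\alpha_1),(m_2,\alpha_2)\in U$ (with $m_1,m_2\in\mathbb{R}^n$, $\alpha_1,\alpha_2\in\mathbb{R}$) and all $a\in[0,1]$, $$\bigl(am_1+(1-a)m_2,\ (e^a-1)^s\alpha_1+(e^{1-a}-1)^s\alpha_2+aG(m_1,m_2,s)\bigr)\in U.$$ *)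

(* Defs.v *)
From mathcomp Require Import all_boot all_order all_algebra.
From mathcomp Require Import all_classical all_reals all_analysis.

Set Implicit Arguments.
Unset Strict Implicit.
Unset Printing Implicit Defensive.

Import Order.TTheory GRing.Theory Num.Theory.

Local Open Scope classical_set_scope.
Local Open Scope ring_scope.

(* Maps on V and on V * V * (0, 1] are given as total functions; only their
   values at points of V (and at parameters s in (0, 1]) are ever constrained.
   At a = 0 (resp. a = 1) the base expR a - 1 (resp. expR (1 - a) - 1) is 0, and
   powR satisfies 0 `^ s = 0 for s != 0, as it should. *)

Definition GS_exp_convex_function (R : realType) (n : nat) (V : set 'rV[R]_n)
    (G : 'rV[R]_n -> 'rV[R]_n -> R -> R) (s : R) (Q : 'rV[R]_n -> R) : Prop :=
  forall m1 m2 : 'rV[R]_n, V m1 -> V m2 ->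
  forall a : R, 0 <= a <= 1 ->
    Q (a *: m1 + (1 - a) *: m2) <=
      (expR a - 1) `^ s * Q m1 + (expR (1 - a) - 1) `^ s * Q m2
      + a * G m1 m2 s.

Definition GS_exp_convex_set (R : realType) (n : nat) (V : set 'rV[R]_n)
    (G : 'rV[R]_n -> 'rV[R]_n -> R -> R) (s : R)
    (U : set ('rV[R]_n * R)) : Prop :=
  [/\ U !=set0,
      U `<=` V `*` [set: R] &
      forall (m1 m2 : 'rV[R]_n) (alpha1 alpha2 : R),
        U (m1, alpha1) -> U (m2, alpha2) ->
      forall a : R, 0 <= a <= 1 ->
        U (a *: m1 + (1 - a) *: m2,
           (expR a - 1) `^ s * alpha1 + (expR (1 - a) - 1) `^ s * alpha2
           + a * G m1 m2 s)].

Definition epigraph (R : realType) (n : nat) (V : set 'rV[R]_n)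
    (Q : 'rV[R]_n -> R) : set ('rV[R]_n * R) :=
  [set p | V p.1 /\ Q p.1 <= p.2].

(* Main.v *)
Require Import Defs.
From mathcomp Require Import all_boot all_order all_algebra.
From mathcomp Require Import all_classical all_reals all_analysis.

(** A point lies in the epigraph of [Q] above [m] exactly when its height
    bounds [Q m]. The heights [alpha1], [alpha2] enter the combined height
    through the coefficients [(expR a - 1) `^ s] and [(expR (1 - a) - 1) `^ s],
    and the powers [powR] are nonnegative. Hence raising [Q m1], [Q m2] to
    [alpha1], [alpha2] can only raise the right-hand side of the convexity
    inequality, so that the inequality for [Q] gives stability of the epigraph;
    convexity of [V] keeps the base point in [V]. Conversely, the lowest points
    [(m1, Q m1)] and [(m2, Q m2)] of the epigraph turn stability back into the
    inequality for [Q]. *)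

Import Order.TTheory GRing.Theory Num.Theory.

Local Open Scope classical_set_scope.
Local Open Scope ring_scope.

(** The convex-space operation is indexed by the bundled type [{i01 R}] and
    convexity is phrased with boolean membership; this is the form with a bare
    real coefficient, as it occurs in the definitions of the two notions. *)
Lemma convex_set_combination (R : realType) (M : lmodType R) (V : set M)
    (x y : M) (a : R) :
  convex_set (V : set (convex_lmodType M)) -> V x -> V y -> 0 <= a <= 1 ->
  V (a *: x + (1 - a) *: y).
Proof.
move=> convV Vx Vy /andP[a_ge0 a_le1].
have := convV x y (Itv01 a_ge0 a_le1) (mem_set Vx) (mem_set Vy).
by rewrite inE.
Qed.

Theorem theorem3p7 (R : realType) (n : nat) (s : R) (V : set 'rV[R]_n)
    (G : 'rV[R]_n -> 'rV[R]_n -> R -> R) (Q : 'rV[R]_n -> R)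
    (hs : 0 < s <= 1) (hV0 : V !=set0)
    (hV : convex_set (V : set (convex_lmodType 'rV[R]_n))) :
  GS_exp_convex_function V G s Q <-> GS_exp_convex_set V G s (epigraph V Q).
Proof.
split=> [convQ | [_ _ stableE] m1 m2 Vm1 Vm2 a a01].
  split.
  - by have [m Vm] := hV0; exists (m, Q m).
  - by move=> p [Vp _]; split.
  - move=> m1 m2 alpha1 alpha2 [/= Vm1 Qm1] [/= Vm2 Qm2] a a01; split=> /=.
      exact: convex_set_combination.
    apply: le_trans (convQ m1 m2 Vm1 Vm2 a a01) _.
    by rewrite lerD2r lerD// ler_wpM2l// powR_ge0.
have lowest m : V m -> epigraph V Q (m, Q m) by move=> Vm; split=> /=.
by have [] := stableE m1 m2 _ _ (lowest _ Vm1) (lowest _ Vm2) a a01.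
Qed.
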